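(* Let $X$ be a Banach space, let $K$ be a weakly compact convex subset of $X$, let $P\subset X$ be a closed convex cone with base, and let $\overline{x}\in \mathrm{Max}(K,P)$. Then $\overline{x}\in\mathrm{StMax}(K,P)$ provided one of the following conditions is satisfied: (i) $0\in\mathrm{PC}\bigl(P,(w,\|\cdot\|)\bigr)$ (equivalently, $P$ has a bounded base); (ii) $\overline{x}\in\mathrm{PC}\bigl(K,(w,\|\cdot\|)\bigr)$.
   Context: $X$ is a real Banach space with closed unit ball $B_X$; $w$ denotes the weak topology. A base of a closed convex cone $P$ is a closed convex subset $\mathcal{B}\subset P$ such that every nonzero $x\in P$ can be represented in a unique way as $x=\lambda b$ with $\lambda>0$ and $b\in\mathcal{B}$; the base is bounded if $\mathcal{B}$ is norm bounded. For a nonempty set $K\subset X$: - $\mathrm{Max}(K,P)=\{x\in K:\ \{x\}=K\cap(x+P)\}$ (maximal elements); - $\mathrm{StMax}(K,P)=\{x\in K:\ \forall\varepsilon>0\ \exists\delta>0,\ (P+\delta B_X)\cap(K-x)\subset\varepsilon B_X\}$ (strictly maximal elements). For a nonempty set $A\subset X$, $\bar a\in A$ is a point of continuity of $A$, written $\bar a\in\mathrm{PC}(A,(w,\|\cdot\|))$, if the identity map $\mathrm{Id}:(A,w)\to(A,\|\cdot\|)$ is continuous at $\bar a$. *)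

(* Defs.v *)
From HB Require Import structures.
From mathcomp Require Import all_boot all_order all_algebra.
From mathcomp Require Import all_classical all_reals all_analysis.

Set Implicit Arguments.
Unset Strict Implicit.
Unset Printing Implicit Defensive.

Import Order.TTheory GRing.Theory Num.Theory.
Import numFieldNormedType.Exports.

Local Open Scope classical_set_scope.
Local Open Scope ring_scope.

Section Defs.
Context {R : realType} {X : normedModType R}.
Implicit Types (A B K P : set X) (a x : X).

(* X with its weak topology, the coarsest one making every norm-continuous
   linear functional continuous. *)
Definition weak_space : topologicalType :=
  sup_topology (fun f : {f : {linear X -> R^o} | continuous f} =>
    Topological.on (initial_topology (sval f))).

Definition weakly_compact K : Prop := compact (K : set weak_space).

(* Nonnegative scalars, so that 0 belongs to every cone. *)
Definition convex_cone P : Prop :=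
  [/\ P !=set0, convex_set P & forall (l : R) x, 0 <= l -> P x -> P (l *: x)].

Definition cone_base P B : Prop :=
  [/\ closed B, convex_set B, B `<=` P &
      forall x, P x -> x != 0 ->
        exists! lb : R * X, [/\ 0 < lb.1, B lb.2 & x = lb.1 *: lb.2]].

Definition unit_ball : set X := [set b | `|b| <= 1].

Definition Max K P : set X :=
  [set x | K x /\ [set x] = K `&` [set x + p | p in P]].

Definition StMax K P : set X :=
  [set x | K x /\
    forall eps : R, 0 < eps -> exists2 delta : R, 0 < delta &
      [set p + delta *: b | p in P & b in unit_ball]
        `&` [set k - x | k in K]
      `<=` [set eps *: b | b in unit_ball]].

(* The points of A at which the identity (A, w) -> (A, |.|) is continuous. *)
Definition PC A : set X :=
  [set a | A a /\
    {for a, continuous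
      (fun y : subspace (A : set weak_space) => (y : X))}].

End Defs.

Arguments weak_space {R} X.

(* Main.v *)
(* Strict maximality: if it fails at [x], there are [k n] in [K] and [p n] in [P]
   with [k n - x - p n --> 0] in norm and [k n - x] bounded away from [0]. Along an
   ultrafilter [k] converges weakly to some [l] in [K], so [p] converges weakly to
   [l - x], which is in [P] because [P] is weakly closed; maximality gives [l = x].
   A point of continuity, of [P] at [0] or of [K] at [x], upgrades one of the two
   weak limits to a norm limit, and then [k n - x --> 0] in norm.

   Bounded bases: both directions produce a continuous linear [g] with
   [|x| <= M * g x] on [P]. From a bounded base, [g] separates the base from [0].
   Conversely, continuity at [0] yields [\sum |x_i| <= D * |\sum x_i|] for finite
   families in [P]; by Hahn-Banach this is what a [g] with [|x| <= g x] requires,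
   and [{x in P | g x = 1}] is then a bounded base. *)
Require Import Defs.
From HB Require Import structures.
From mathcomp Require Import all_boot all_order all_algebra.
From mathcomp Require Import all_classical all_reals all_analysis.
From mathcomp Require Import ring lra.
Import Order.TTheory GRing.Theory Num.Theory.
Import numFieldNormedType.Exports.
Local Open Scope classical_set_scope.
Local Open Scope ring_scope.

Set Implicit Arguments.
Unset Strict Implicit.

(** * Sublinear functionals and the Hahn-Banach theorem *)

Section sublinear_functionals.
Context {R : realType} {V : lmodType R}.
Implicit Types (p q : V -> R) (E : V -> R -> Prop).

(** An inequality suffices in the second clause: scaling back by [t^-1] gives equality. *)
Definition sublinear q :=
  (forall x y, q (x + y) <= q x + q y) /\
  (forall (t : R) x, 0 < t -> q (t *: x) <= t * q x).

(** A convex cone in [V * R]; a pair [(e, t)] stands for the constraint [t <= g e] on a functional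
    [g] to be constructed. *)
Definition additive_cone E :=
  [/\ E 0 0,
      forall x y s t, E x s -> E y t -> E (x + y) (s + t) &
      forall (l : R) x t, 0 < l -> E x t -> E (l *: x) (l * t)].

Lemma sublinearZ q (t : R) x : sublinear q -> 0 < t -> q (t *: x) = t * q x.
Proof.
move=> [_ qZ] t0; apply/eqP; rewrite eq_le qZ//=.
have := qZ t^-1 (t *: x); rewrite invr_gt0 scalerA mulVf ?gt_eqF// scale1r.
by move=> /(_ t0); rewrite ler_pdivlMl.
Qed.

Lemma sublinear0 q : sublinear q -> q 0 = 0.
Proof.
move=> sq; have := @sublinearZ q 2 0 sq (ltr0n _ _); rewrite scaler0; lra.
Qed.

Lemma sublinear_ge_opp q x : sublinear q -> - q (- x) <= q x.
Proof.
move=> sq; have := sq.1 x (- x); rewrite subrr sublinear0//; lra.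
Qed.

(* [p y] is the infimum of [q (y + e) - t] over the pairs [(e, t)] in [E]. *)
Lemma sublinear_lower q E : sublinear q -> additive_cone E ->
  (forall e t, E e t -> t <= q e) ->
  exists p, [/\ sublinear p, forall x, p x <= q x &
    forall e t, E e t -> p (- e) <= - t].
Proof.
move=> sq [E0 ED EZ] Eq.
pose S y := [set r | exists e t, E e t /\ r = q (y + e) - t].
have S0 y : S y !=set0 by exists (q (y + 0) - 0); exists 0, 0.
have Slb y : has_lbound (S y).
  (* [t <= q e <= q (y + e) + q (- y)], so the infimum is finite. *)
  exists (- q (- y)) => r [e [t [Eet ->]]].
  have := Eq _ _ Eet; have := sq.1 (y + e) (- y).
  rewrite addrAC subrr add0r; lra.
have infle y r : S y r -> inf (S y) <= r by move=> ?; exact: ge_inf.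
exists (fun y => inf (S y)); split.
- split => [x y|t x t0].
  + rewrite -lerBlDl; apply: lb_le_inf => // _ [e [t [Eet ->]]].
    rewrite lerBlDl -lerBlDr; apply: lb_le_inf => // _ [e' [t' [Eet' ->]]].
    rewrite lerBlDr; apply: (@le_trans _ _ (q (x + y + (e' + e)) - (t' + t))).
      by apply: infle; exists (e' + e), (t' + t); split => //; exact: ED.
    by have := sq.1 (x + e') (y + e); rewrite addrACA; lra.
  + rewrite -ler_pdivrMl//; apply: lb_le_inf => // _ [e [s [Ees ->]]].
    rewrite ler_pdivrMl//; apply: (@le_trans _ _ (q (t *: x + t *: e) - t * s)).
      by apply: infle; exists (t *: e), (t * s); split => //; exact: EZ.
    by rewrite -scalerDr sublinearZ// mulrBr.
- by move=> x; apply: infle; exists 0, 0; rewrite addr0 subr0.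
- move=> e t Eet; apply: infle; exists e, t; split => //.
  by rewrite addNr sublinear0// add0r.
Qed.

(** Zorn's lemma for the reversed pointwise order. A nonempty chain is bounded by its pointwise
    infimum, finite because [- q (- x) <= p x] for each sublinear [p <= q]. *)
Lemma sublinear_minimal q : sublinear q ->
  exists p, [/\ sublinear p, forall x, p x <= q x &
    forall p', sublinear p' -> (forall x, p' x <= p x) -> p' = p].
Proof.
move=> sq; pose T := {p : V -> R | sublinear p /\ forall x, p x <= q x}.
pose le (p p' : T) := `[< forall x, sval p' x <= sval p x >].
have [||||[p [sp pq]] pmin] := @Zorn T le.
- by move=> p; exact/asboolP.
- move=> p1 p2 p3 /asboolP h1 /asboolP h2; apply/asboolP => x.
  exact: le_trans (h1 x).
- move=> [p1 ?] [p2 ?] /asboolP/= h1 /asboolP/= h2; apply: eq_exist.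
  apply/funext => x.
  by apply/eqP; rewrite eq_le h1 h2.
- move=> A Atot; have [[p0 Ap0]|A0] := pselect (A !=set0); last first.
    have qq : sublinear q /\ forall x, q x <= q x by [].
    by exists (exist _ q qq) => p Ap; exfalso; apply: A0; exists p.
  pose S x := [set sval p x | p in A].
  have S0 x : S x !=set0 by exists (sval p0 x); exists p0.
  have Slb x : has_lbound (S x).
    exists (- q (- x)) => _ [p Ap <-]; have [sp pq] := svalP p.
    apply: le_trans _ (sublinear_ge_opp x sp); rewrite lerN2; exact: pq.
  have infle x (p : T) : A p -> inf (S x) <= sval p x.
    by move=> Ap; apply: ge_inf => //; exists p.
  have sS : sublinear (fun x => inf (S x)) /\ forall x, inf (S x) <= q x.
    split; last by move=> x; apply: le_trans (infle x p0 Ap0) _; case: (svalP p0).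
    split => [x y|t x t0].
    + rewrite -lerBlDl; apply: lb_le_inf => // _ [p Ap <-].
      rewrite lerBlDl -lerBlDr; apply: lb_le_inf => // _ [p' Ap' <-].
      rewrite lerBlDr.
      (* The smaller of [p] and [p'] serves at both points. *)
      have [/asboolP pp'|/asboolP pp'] := Atot _ _ Ap Ap'.
        have [[sp' _] _] := svalP p'; apply: le_trans (infle _ p' Ap') _.
        by apply: le_trans (sp' _ _) _; rewrite lerD2l.
      have [[sp' _] _] := svalP p; apply: le_trans (infle _ _ Ap) _.
      by apply: le_trans (sp' _ _) _; rewrite lerD2r.
    + rewrite -ler_pdivrMl//; apply: lb_le_inf => // _ [p Ap <-].
      rewrite ler_pdivrMl//; apply: le_trans (infle _ _ Ap) _.
      by have [[_ sp] _] := svalP p; exact: sp.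
  exists (exist (fun p : V -> R => sublinear p /\ forall x, p x <= q x) _ sS).
  by move=> p Ap; apply/asboolP => x /=; exact: infle.
exists p; split => // p' sp' p'p.
have p'q : sublinear p' /\ forall x, p' x <= q x.
  by split => // x; exact: le_trans (p'p x) (pq x).
by have /(congr1 sval) := pmin (exist _ p' p'q) (asboolT p'p).
Qed.

(* A minimal sublinear functional is odd, since [sublinear_lower] applied to the
   ray through [(v, p v)] cannot decrease it. *)
Lemma hahn_banach q : sublinear q ->
  exists g : {linear V -> R^o}, forall x, g x <= q x.
Proof.
move=> /sublinear_minimal[p [sp pq pmin]].
have pN v : p (- v) = - p v.
  pose E x t := exists2 l : R, 0 <= l & x = l *: v /\ t = l * p v.
  have cE : additive_cone E.
    split=> [|x y s t [l l0 [-> ->]] [k k0 [-> ->]]|l x t l0 [k k0 [-> ->]]].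
    - by exists 0; rewrite ?scale0r ?mul0r.
    - by exists (l + k); rewrite ?addr_ge0// scalerDl mulrDl.
    - exists (l * k); first by rewrite mulr_ge0 ?(ltW l0).
      by rewrite scalerA mulrA.
  have Ep e t : E e t -> t <= p e.
    move=> [l]; rewrite le_eqVlt => /predU1P[<-|l0] [-> ->].
      by rewrite scale0r mul0r sublinear0.
    by rewrite sublinearZ.
  have [p' [sp' p'p p'E]] := sublinear_lower sp cE Ep.
  have p'e := pmin _ sp' p'p; rewrite p'e in p'E.
  apply/eqP; rewrite eq_le p'E/=; last by exists 1; rewrite ?scale1r ?mul1r.
  by have := sublinear_ge_opp (- v) sp; rewrite opprK.
have pD x y : p (x + y) = p x + p y.
  apply/eqP; rewrite eq_le sp.1/=.
  by have := sp.1 (x + y) (- y); rewrite addrK pN; lra.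
have lin : linear (p : V -> R^o).
  move=> t x y; rewrite pD; congr (_ + _).
  have [t0|t0|->] := ltgtP t 0.
  - rewrite -[t in LHS]opprK scaleNr pN sublinearZ ?oppr_gt0//.
    by rewrite mulNr opprK.
  - exact: sublinearZ.
  - by rewrite scale0r sublinear0// scale0r.
pose g : {linear V -> R^o} :=
  HB.pack (p : V -> R^o) (GRing.isLinear.Build _ _ _ _ _ lin).
by exists g => x; exact: pq.
Qed.

End sublinear_functionals.

(** * Separation by continuous linear functionals; ultrafilter limits *)

Section normed.
Context {R : realType} {X : normedModType R}.
Implicit Types (f g : {linear X -> R^o}) (A P : set X).

Lemma linear_le_norm_continuous f (C : R) :
  (forall x, f x <= C * `|x|) -> continuous f.
Proof.
move=> fC; apply/linear_bounded_continuous/bounded_funP => r.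
exists (`|C| * r) => x xr; rewrite ler_norml.
have h y : `|y| = `|x| -> f y <= `|C| * r.
  move=> yx; apply: le_trans (fC y) _; rewrite yx.
  apply: (@le_trans _ _ (`|C| * `|x|)); first by rewrite ler_wpM2r// ler_norm.
  by rewrite ler_wpM2l.
by rewrite h// andbT lerNl -linearN h// normrN.
Qed.

Lemma continuous_linear_le_norm f : continuous f ->
  exists2 C : R, 0 < C & forall x, `|f x| <= C * `|x|.
Proof.
move=> /linear_bounded_continuous/linear_boundedP/pinfty_ex_gt0[C C0 h].
by exists C.
Qed.

(** Lowering [C * |x|] along [E] before applying Hahn-Banach forces [g (- e) <= - t]; continuity
    follows from [g x <= C * |x|]. *)
Lemma cone_separation (E : X -> R -> Prop) (C : R) : 0 < C -> additive_cone E ->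
  (forall e t, E e t -> t <= C * `|e|) ->
  exists g, continuous g /\ forall e t, E e t -> t <= g e.
Proof.
move=> C0 cE Et.
have sC : sublinear (fun x : X => C * `|x|).
  split=> [x y|t x t0]; first by rewrite -mulrDr ler_pM2l// ler_normD.
  by rewrite normrZ gtr0_norm// mulrCA.
have [p [sp pC pE]] := sublinear_lower sC cE Et.
have [g gp] := hahn_banach sp.
exists g; split.
  by apply: (@linear_le_norm_continuous _ C) => x; exact: le_trans (gp x) (pC x).
move=> e t Eet; rewrite -lerN2 -linearN.
exact: le_trans (gp _) (pE _ _ Eet).
Qed.

End normed.

(** [F] contains the preimage of [A] or of its complement, so a proper filter finer than the image
    cannot gain a new set [A]. *)
Lemma ultra_fmap (T U : Type) (f : T -> U) (F : set_system T) :
  UltraFilter F -> UltraFilter (f @ F).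
Proof.
move=> FU; split=> [|G GF FG]; first exact: fmap_proper_filter.
apply/seteqP; split => // A GA.
have [//|nFA] := in_ultra_setVsetC (f @^-1` A) FU.
have /FG GnA : (f @ F) (~` A) by [].
by exfalso; apply: (@filter_not_empty _ G GF); rewrite -(setICr A); exact: filterI.
Qed.

Lemma ultra_bounded_cvg (R : realType) (T : Type) (U : set_system T)
    (u : T -> R) (M : R) :
  UltraFilter U -> (\forall t \near U, `|u t| <= M) -> cvg (u @ U).
Proof.
move=> UU uM; have := @segment_compact R (- M) M; rewrite compact_ultra.
move=> /(_ _ (ultra_fmap u UU))[|l [_ ul]]; last by apply/cvg_ex; exists l.
by apply: filterS uM => t; rewrite /= in_itv/= ler_norml.
Qed.

(** * Weak convergence and points of continuity *)

Section weak_topology.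
Context {R : realType} {X : normedModType R}.
Implicit Types (A B P : set X) (a x : X).

Lemma weak_cvgP (F : set_system X) a : Filter F ->
  (F --> (a : weak_space X)) <->
  (forall f : {linear X -> R^o}, continuous f -> f @ F --> f a).
Proof.
move=> FF; split => [Fa f cf|Ff].
  have := (@cvg_sup X _ (fun f : {f : {linear X -> R^o} | continuous f} =>
    Topological.on (initial_topology (sval f))) F a FF).1 Fa (exist _ f cf).
  move=> /= Ffa; apply: cvg_trans (@initial_continuous X R^o f a).
  by move=> B; apply: Ffa.
apply/cvg_sup => -[f cf] B /= [_ [[C oC <-] Cfa] CB].
apply: (filterS CB); apply: (Ff f cf); exact: open_nbhs_nbhs.
Qed.

(** As [F A] holds, [F] also converges to [a] in the weak subspace topology of [A], where the
    identity is continuous at [a]. *)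
Lemma PC_cvg A a (F : set_system X) : Filter F -> PC A a -> F A ->
  F --> (a : weak_space X) -> F --> a.
Proof.
move=> FF [Aa cA] FA Fa; apply: cvg_trans cA => B.
rewrite /= /nbhs/= -(@nbhs_subspace_in (weak_space X) A)//.
move=> /= /Fa; rewrite nbhs_filterE/= => FB.
by apply: filterS2 FA FB => x Ax; exact.
Qed.

(** On [A] the weak neighbourhood [|g x - g a| < e / M] of [a] lies in the ball of radius [e]. *)
Lemma PC_bounded_functional A a (g : {linear X -> R^o}) (M : R) :
  A a -> continuous g -> 0 < M ->
  (forall x, A x -> `|x - a| <= M * g (x - a)) -> PC A a.
Proof.
move=> Aa cg M0 Ag; split => // B /nbhs_ballP[e /= e0 eB].
rewrite nbhs_filterE /= /nbhs/= -(@nbhs_subspace_in (weak_space X) A)//.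
have FF : Filter (nbhs (a : weak_space X)) := @nbhs_filter (weak_space X) a.
have := (weak_cvgP a FF).1 (@cvg_id _ _) g cg.
move=> /cvgrPdist_lt/(_ (e / M)); rewrite divr_gt0// => /(_ isT).
apply: filterS => x gx Ax; apply: eB.
rewrite -ball_normE/= distrC; apply: le_lt_trans (Ag _ Ax) _.
rewrite mulrC -ltr_pdivlMr//; apply: le_lt_trans gx.
by rewrite distrC linearB ler_norm.
Qed.

End weak_topology.

(** * Convex cones: weak closedness and bases *)

Section cones.
Context {R : realType} {X : normedModType R}.
Implicit Types (A B P : set X) (x y : X).

Lemma convex_set_comb A x y (t : R) : convex_set A -> A x -> A y ->
  0 <= t -> t <= 1 -> A (t *: x + (1 - t) *: y).
Proof.
move=> cA Ax Ay t0 t1.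
by have := cA x y (Itv01 t0 t1); rewrite !inE; exact.
Qed.

Lemma convex_cone0 P : convex_cone P -> P 0.
Proof. by move=> [[x Px] _ PZ]; rewrite -(scale0r x); exact: PZ. Qed.

Lemma convex_coneD P x y : convex_cone P -> P x -> P y -> P (x + y).
Proof.
move=> [_ cP PZ] Px Py.
have h : 0 <= 2^-1 :> R by rewrite invr_ge0.
have := convex_set_comb cP Px Py h _.
have -> : 1 - 2^-1 = 2^-1 :> R by lra.
move=> /(_ _)/(PZ 2 _ (ler0n _ _)); rewrite -scalerDr scalerA divff ?scale1r//.
by apply; lra.
Qed.

(** Mazur's theorem for cones: if [x] were outside [P], some continuous [g] would be nonnegative on
    [P] with [g x <= -1], while [g x] is a limit of nonnegative values. *)
Lemma cone_weakly_closed P x (F : set_system X) : ProperFilter F ->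
  closed P -> convex_cone P -> F P -> F --> (x : weak_space X) -> P x.
Proof.
move=> FF clP coP FP Fx; apply: contrapT => nPx.
have [d d0 dP] : exists2 d : R, 0 < d & forall p, P p -> d <= `|x - p|.
  have /nbhs_ballP[d /= d0 dP] : nbhs x (~` P).
    by apply: open_nbhs_nbhs; split => //; exact: closed_openC.
  exists d => // p Pp; rewrite leNgt; apply/negP => xp.
  by apply: (dP p) => //; rewrite -ball_normE.
(* Generated by [P * {0}] and [(- x, 1)]: the constraints [0 <= g] on [P] and [1 <= g (- x)]. *)
pose E (y : X) (t : R) := exists2 p, P p & 0 <= t /\ y = p - t *: x.
have PZ : forall l y, 0 <= l -> P y -> P (l *: y) by case: coP.
have cE : additive_cone E.
  split=> [|y z s t [p Pp [s0 ->]] [q Pq [t0 ->]]|l y t l0 [p Pp [t0 ->]]].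
  - by exists 0; [exact: convex_cone0|rewrite scale0r subr0].
  - exists (p + q); first exact: convex_coneD.
    by rewrite addr_ge0// scalerDl opprD addrACA.
  - exists (l *: p); first by apply: PZ => //; exact: ltW.
    by rewrite mulr_ge0 ?(ltW l0)// scalerBr scalerA.
have [|e t [p Pp [t0 ->]]|g [cg gE]] := @cone_separation _ _ E d^-1 _ cE.
- by rewrite invr_gt0.
(* For [0 < t], [|p - t *: x| = t * |x - t^-1 *: p| >= t * d]. *)
- rewrite ler_pdivlMl// mulrC; have [->|tn0] := eqVneq t 0; first by rewrite mul0r.
  have tp : 0 < t by rewrite lt_def tn0.
  rewrite -ler_pdivlMl//; apply: le_trans (dP _ (PZ t^-1 p _ Pp)) _.
    by rewrite invr_ge0.
  have -> : x - t^-1 *: p = - (t^-1 *: (p - t *: x)).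
    by rewrite scalerBr scalerA mulVf// scale1r opprB.
  by rewrite normrN normrZ ger0_norm// invr_ge0.
have gP p : P p -> 0 <= g p.
  by move=> Pp; apply: gE; exists p => //; rewrite scale0r subr0.
have gx : g x <= -1.
  rewrite lerNr -linearN; apply: gE; exists 0; first exact: convex_cone0.
  by rewrite scale1r sub0r.
have /(weak_cvgP _ _)/(_ g cg) gF := Fx.
have : 0 <= g x.
  apply: (@closed_cvg _ R^o F _ g [set y | 0 <= y]) gF; first exact: closed_ge.
  by apply: filterS FP => p; exact: gP.
lra.
Qed.

(** If [B] contained [0], it would contain [2^-1 *: b], and [l *: b = (2 * l) *: (2^-1 *: b)] would
    give two representations of [x]. *)
Lemma cone_base_neq0 P B x : cone_base P B -> P x -> x != 0 -> ~ B 0.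
Proof.
move=> [clB cB BP uB] Px x0 B0.
have [[l b] [[/= l0 Bb xlb] luniq]] := uB x Px x0.
suff [l2 _] : (l, b) = (2 * l, 2^-1 *: b) by move: l0 l2; lra.
apply: luniq; split => /=; first by rewrite mulr_gt0.
- have h : 0 <= 2^-1 :> R by rewrite invr_ge0.
  have := convex_set_comb cB Bb B0 h; rewrite scaler0 addr0; apply; lra.
- by rewrite scalerA mulrAC mulfV// mul1r.
Qed.

(** For [0 < s + t], [d] is the average of [b] and [c] with weights proportional to [s] and [t];
    otherwise both scalars vanish and any element serves. *)
Lemma cone_base_sum P B (s t : R) b c : cone_base P B -> 0 <= s -> 0 <= t ->
  B b -> B c -> exists2 d, B d & s *: b + t *: c = (s + t) *: d.
Proof.
move=> [_ cB _ _] s0 t0 Bb Bc.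
have [st0|stn0] := eqVneq (s + t) 0.
  exists b => //; have -> : s = 0 by move: s0 t0 st0; lra.
  have -> : t = 0 by move: s0 t0 st0; lra.
  by rewrite addr0 !scale0r addr0.
have st : 0 < s + t by rewrite lt_def stn0 addr_ge0.
exists ((s / (s + t)) *: b + (1 - s / (s + t)) *: c).
  apply: convex_set_comb => //; first by rewrite divr_ge0// ltW.
  by rewrite ler_pdivrMr// mul1r lerDl.
rewrite scalerDr !scalerA mulrBr mulr1 mulrCA divff// mulr1; congr (_ + _ *: _).
by rewrite addrC addKr.
Qed.

(** A nonzero [x] would make [0 = x + (- x)] a positive multiple of a point of [B], putting [0] in
    [B]. *)
Lemma cone_base_pointed P B x : cone_base P B -> P x -> P (- x) -> x = 0.
Proof.
move=> bB Px PNx; apply/eqP; apply: contrapT => /negP x0.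
have B0 := cone_base_neq0 bB Px x0.
have [_ _ _ uB] := bB.
have [[l b] [[/= l0 Bb xlb] _]] := uB _ Px x0.
have [|[k c] [[/= k0 Bc xkc] _]] := uB _ PNx; first by rewrite oppr_eq0.
have [d Bd] := cone_base_sum bB (ltW l0) (ltW k0) Bb Bc.
rewrite -xlb -xkc subrr => /esym/eqP; rewrite scaler_eq0 gt_eqF ?addr_gt0//=.
by move=> /eqP d0; apply: B0; rewrite -d0.
Qed.

Lemma bounded_base_PC P B : convex_cone P -> cone_base P B -> bounded_set B ->
  PC P 0.
Proof.
move=> coP bB /pinfty_ex_gt0[M M0 BM].
have P0 := convex_cone0 coP; have [clB _ BP uB] := bB.
(* [P = {0}] is treated apart, as a base may then contain [0]; the zero functional serves. *)
have [[z Pz z0]|P00] := pselect (exists2 z, P z & z != 0); last first.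
  apply: (@PC_bounded_functional _ _ _ _ \0 1) => // [x|x Px].
    exact: cvg_cst.
  have -> : x = 0.
    by apply/eqP; apply: contrapT => /negP xn0; apply: P00; exists x.
  by rewrite subrr normr0 mulr0.
have B0 := cone_base_neq0 bB Pz z0.
have [d d0 dB] : exists2 d : R, 0 < d & forall b, B b -> d <= `|b|.
  have /nbhs_ballP[d /= d0 dB] : nbhs 0 (~` B).
    by apply: open_nbhs_nbhs; split => //; exact: closed_openC.
  exists d => // b Bb; rewrite leNgt; apply/negP => xb.
  by apply: (dB b) => //; rewrite -ball_normE/= sub0r normrN.
have [[l b0] [[_ /= Bb0 _] _]] := uB z Pz z0.
(* The constraint [1 <= g] on [B], extended to the cone; [d] bounds the norm on [B] from below,
   hence the constant [d^-1]. *)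
pose E (y : X) (t : R) := 0 <= t /\ exists2 b, B b & y = t *: b.
have cE : additive_cone E.
  split=> [|y w s t [s0 [b Bb ->]] [t0 [c Bc ->]]|k y t k0 [t0 [b Bb ->]]].
  - by split => //; exists b0; rewrite ?scale0r.
  - split; first exact: addr_ge0.
    by have [e Be ->] := cone_base_sum bB s0 t0 Bb Bc; exists e.
  - by split; [rewrite mulr_ge0 ?(ltW k0)|exists b; rewrite ?scalerA].
have [|e t [t0 [b Bb ->]]|g [cg gE]] := @cone_separation _ _ E d^-1 _ cE.
- by rewrite invr_gt0.
- rewrite ler_pdivlMl// normrZ ger0_norm// mulrC ler_wpM2l//; exact: dB.
apply: (@PC_bounded_functional _ _ _ _ g M) => // x Px; rewrite subr0.
have [->|x0] := eqVneq x 0; first by rewrite normr0 linear0 mulr0.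
have [[t b] [[/= t0 Bb ->] _]] := uB x Px x0.
have : t <= g (t *: b) by apply: gE; split; [exact: ltW|exists b].
rewrite normrZ gtr0_norm// => tg; rewrite mulrC.
apply: (@le_trans _ _ (M * t)); first by rewrite ler_wpM2r ?(ltW t0)//; exact: BM.
by rewrite ler_pM2l.
Qed.

End cones.

Lemma cvg0_le_harmonic (R : realType) (X : normedModType R) (u : nat -> X) :
  (forall n, `|u n| <= n.+1%:R^-1) -> u @ \oo --> (0 : X).
Proof.
move=> u_le; apply/cvgr0Pnorm_lt => e e0.
have /cvgr0Pnorm_lt/(_ e e0) := @cvg_harmonic R.
by apply: filterS => n; rewrite ger0_norm ?harmonic_ge0//; exact: le_lt_trans (u_le n).
Qed.

(** * Continuity at [0]: normality, summation estimates and a bounded base *)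

Section normal.
Context {R : realType} {X : completeNormedModType R}.
Implicit Types (B P : set X) (x : X).

(* If the estimate failed, there would be [u n], [v n] in [P] with [|u n| = 1]
   and [u n + v n --> 0]. Along an ultrafilter each [f (u n)] converges, hence
   [u n + v m --> 0] weakly in [(n, m)], and in norm since [0] is a point of
   continuity. So [u] is Cauchy, and its limit [x] satisfies [|x| = 1], [P x] and
   [P (- x)]. *)
Lemma PC_cone_normal P : closed P -> convex_cone P ->
  (forall x, P x -> P (- x) -> x = 0) -> PC P 0 ->
  exists2 C : R, 0 < C & forall x y, P x -> P y -> `|x| <= C * `|x + y|.
Proof.
move=> clP coP ptP pcP.
have PZ : forall (l : R) y, 0 <= l -> P y -> P (l *: y) by case: coP.
apply: contrapT => nC.
have /choice[uv uvP] (n : nat) : exists uv : X * X,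
    [/\ P uv.1, P uv.2, `|uv.1| = 1 & `|uv.1 + uv.2| <= n.+1%:R^-1].
  have /existsNP[x /existsNP[y]] :
      ~ forall x y, P x -> P y -> `|x| <= n.+1%:R * `|x + y|.
    by move=> h; apply: nC; exists n.+1%:R.
  move=> /not_implyP[Px /not_implyP[Py /negP]]; rewrite -ltNge => xy.
  have x0 : 0 < `|x| by apply: le_lt_trans xy; rewrite mulr_ge0.
  have nx0 : 0 <= `|x|^-1 by rewrite invr_ge0.
  exists (`|x|^-1 *: x, `|x|^-1 *: y); split => /=; try exact: PZ.
    by rewrite normrZ ger0_norm// mulVf// gt_eqF.
  rewrite -scalerDr normrZ ger0_norm// ler_pdivrMl// ler_pdivlMr//.
  by rewrite mulrC; exact: ltW.
pose u n := (uv n).1; pose v n := (uv n).2.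
have [U [UU ooU]] := ultraFilterLemma eventually_filter.
have UF : ProperFilter U by exact: ultra_proper.
have uv0 : (u n + v n) @[n --> U] --> (0 : X).
  apply: cvg_trans (@cvg0_le_harmonic R X (fun n => u n + v n) _).
    exact: cvg_app.
  by move=> n; have [] := uvP n.
pose w (nm : nat * nat) := u nm.1 + v nm.2.
have w_weak : w @ filter_prod U U --> (0 : weak_space X).
  apply/weak_cvgP => f cf; rewrite linear0.
  have [M M0 fM] := continuous_linear_le_norm cf.
  have /cvg_ex[l fl] : cvg ((f \o u) @ U).
    apply: (@ultra_bounded_cvg R _ _ _ M); apply: nearW => n /=.
    by have [_ _ u1 _] := uvP n; rewrite (le_trans (fM _))// u1 mulr1.
  have fuv : f (u n + v n) @[n --> U] --> (0 : R^o).
    by rewrite -(linear0 f); apply: (continuous_cvg _ (cf 0)).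
  suff : (f \o w) @ filter_prod U U --> (0 : R^o) by [].
  (* Inserting [u m] leaves controlled terms: [f (u n)] and [f (u m)] share the limit [l], and
     [f (u m + v m)] tends to [0]. *)
  have -> : f \o w = fun nm => f (u nm.1) + f (u nm.2 + v nm.2) - f (u nm.2).
    by apply/funext => nm /=; rewrite /w !linearD/=; lra.
  have -> : (0 : R^o) = l + 0 - l by rewrite addr0 subrr.
  apply: (@cvgB _ R^o); first apply: (@cvgD _ R^o).
  - exact: (@cvg_comp _ _ _ fst (f \o u) _ _ _ cvg_fst fl).
  - exact: (@cvg_comp _ _ _ snd (fun n => f (u n + v n)) _ _ _ cvg_snd fuv).
  - exact: (@cvg_comp _ _ _ snd (f \o u) _ _ _ cvg_snd fl).
have w0 : w @ filter_prod U U --> (0 : X).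
  apply: (PC_cvg _ pcP _ w_weak); rewrite /= nbhs_simpl; apply: filterE => nm.
  by apply: convex_coneD => //; have [] := uvP nm.1; have [] := uvP nm.2.
(* [u n - u m = w (n, m) - (u m + v m)], where both terms tend to [0] in norm. *)
have uu0 : (u nm.1 - u nm.2) @[nm --> filter_prod U U] --> (0 : X).
  have -> : (fun nm => u nm.1 - u nm.2) =
      (fun nm => w nm - (u nm.2 + v nm.2)).
    by apply/funext => nm; rewrite /w opprD addrACA subrr addr0.
  rewrite -[X in _ --> X](subr0 (0 : X)); apply: cvgB => //.
  exact: (@cvg_comp _ _ _ snd (fun n => u n + v n) _ _ _ cvg_snd uv0).
have /cauchy_cvgP/cvg_ex[x ux] : cauchy (u @ U).
  apply/cauchy_ballP => e e0.
  have /cvgr0Pnorm_lt/(_ e e0)[[A1 A2] [/= UA1 UA2] A12] := uu0.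
  exists (u @` A1, u @` A2) => /=.
    by split; [apply: (@filterS _ U _ A1)|apply: (@filterS _ U _ A2)] => // n An;
      exists n.
  move=> [_ _] [/= [n An <-] [m Am <-]]; rewrite -ball_normE.
  exact: (A12 (n, m)).
have vx : v @ U --> - x.
  have -> : v = (fun n => (u n + v n) - u n).
    by apply/funext => n; rewrite addrAC subrr add0r.
  by rewrite -[- x]sub0r; exact: cvgB.
have Px : P x.
  apply: (@closed_cvg _ X U _ u P clP _ x ux); apply: nearW => n.
  by have [] := uvP n.
have PNx : P (- x).
  apply: (@closed_cvg _ X U _ v P clP _ (- x) vx); apply: nearW => n.
  by have [] := uvP n.
have : `|x| = 1.
  apply: (@cvg_unique _ (@Rhausdorff R) _ _ _ _ (cvg_norm ux)).
  by apply: cvg_near_cst; apply: nearW => n; have [] := uvP n.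
by rewrite (ptP x Px PNx) normr0 => /eqP; rewrite eq_sym oner_eq0.
Qed.

Lemma convex_cone_sum P (s : seq X) : convex_cone P ->
  (forall x, x \in s -> P x) -> P (\sum_(x <- s) x).
Proof.
move=> coP sP; rewrite big_seq; elim/big_ind : _ => //.
- exact: convex_cone0.
- by move=> x y; exact: convex_coneD.
Qed.

(** Splitting the family by the sign of [f] into sums [a] and [b] turns the left side into
    [f a - f b]. Normality bounds [|a|] and [|b|] by [C * |a + b|], whence [D = 2 * M * C] with [M]
    a bound for [f]. *)
Lemma normal_cone_sum_functional P (f : {linear X -> R^o}) (C : R) :
  convex_cone P -> continuous f -> 0 < C ->
  (forall x y, P x -> P y -> `|x| <= C * `|x + y|) ->
  exists2 D : R, 0 < D & forall s : seq X, (forall x, x \in s -> P x) ->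
    \sum_(x <- s) `|f x| <= D * `|\sum_(x <- s) x|.
Proof.
move=> coP cf C0 PC; have [M M0 fM] := continuous_linear_le_norm cf.
exists (2 * M * C); first by rewrite !mulr_gt0.
move=> s sP; have P0 := convex_cone0 coP.
have [a [b [Pa Pb <- ->]]] : exists a b, [/\ P a, P b,
    a + b = \sum_(x <- s) x & \sum_(x <- s) `|f x| = f a - f b].
  elim: s sP => [_|x s IH sP].
    by exists 0, 0; rewrite !big_nil addr0 subrr.
  have [|a [b [Pa Pb abs fab]]] := IH.
    by move=> y ys; apply: sP; rewrite inE ys orbT.
  have Px : P x by apply: sP; rewrite inE eqxx.
  rewrite !big_cons -abs fab; have [fx|fx] := leP 0 (f x).
  - exists (x + a), b; split => //; first exact: convex_coneD.
      by rewrite addrA.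
    by rewrite (ger0_norm fx) linearD/= addrA.
  - exists a, (x + b); split => //; first exact: convex_coneD.
      by rewrite addrCA.
    by rewrite (ltr0_norm fx) linearD/=; lra.
have := fM a; have := fM b; have := PC a b Pa Pb.
have := PC b a Pb Pa; rewrite (addrC b) => hb ha fb fa.
have := ler_norm (f a); have := lerNnormlW (lexx `|f b|).
have : M * `|a| <= M * (C * `|a + b|) by rewrite ler_pM2l.
have : M * `|b| <= M * (C * `|a + b|) by rewrite ler_pM2l.
have -> : 2 * M * C * `|a + b| = M * (C * `|a + b|) + M * (C * `|a + b|) by ring.
move: (M * (C * _)) => z; lra.
Qed.

(* The sets [{h < 1}], for [h] positively homogeneous and satisfying the estimate
   of [normal_cone_sum_functional], generate a filter finer than the weak
   neighbourhoods of [0]; one of them therefore meets [P] inside the unit ball,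
   which means [|x| <= h x] on [P]. *)
Lemma PC_cone_sum_norm P : closed P -> convex_cone P ->
  (forall x, P x -> P (- x) -> x = 0) -> PC P 0 ->
  exists2 D : R, 0 < D & forall s : seq X, (forall x, x \in s -> P x) ->
    \sum_(x <- s) `|x| <= D * `|\sum_(x <- s) x|.
Proof.
move=> clP coP ptP pcP; have [C C0 PC] := PC_cone_normal clP coP ptP pcP.
have PZ : forall (l : R) y, 0 <= l -> P y -> P (l *: y) by case: coP.
pose H := [set h : X -> R | [/\ forall x, 0 <= h x,
    forall (l : R) x, 0 < l -> h (l *: x) = l * h x &
    exists2 D : R, 0 < D & forall s : seq X, (forall x, x \in s -> P x) ->
      \sum_(x <- s) h x <= D * `|\sum_(x <- s) x|]].
pose G := filter_from H (fun h => [set x | h x < 1]).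
have GF : Filter G.
  apply: filter_from_filter.
    exists (fun=> 0); split => //; first by move=> *; rewrite mulr0.
    by exists 1 => // s _; rewrite big1.
  move=> h k [h0 hZ [D D0 hD]] [k0 kZ [E E0 kE]].
  (* As the values are nonnegative, [h x + k x < 1] implies both [h x < 1] and [k x < 1]. *)
  exists (fun x => h x + k x).
    split=> [x|l x l0|]; first exact: addr_ge0.
      by rewrite hZ// kZ// mulrDr.
    exists (D + E); first exact: addr_gt0.
    by move=> s sP; rewrite big_split mulrDl lerD ?hD ?kE.
  by move=> x /=; have := h0 x; have := k0 x; split => /=; lra.
have Gweak : within P G --> (0 : weak_space X).
  apply/weak_cvgP => f cf; rewrite linear0.
  apply: (@cvg_trans _ (f @ G)); first exact/cvg_app/cvg_within.
  apply/cvgr0Pnorm_lt => e e0.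
  have [D D0 fD] := normal_cone_sum_functional coP cf C0 PC.
  (* For this choice, being less than [1] means [|f x| < e]. *)
  exists (fun x => e^-1 * `|f x|) => [|x /=]; last by rewrite ltr_pdivrMl// mulr1.
  split=> [x|l x l0|]; first by rewrite mulr_ge0// invr_ge0 ltW.
    by rewrite linearZ/= normrM gtr0_norm// mulrCA.
  exists (e^-1 * D); first by rewrite mulr_gt0// invr_gt0.
  move=> s sP; rewrite -mulr_sumr -mulrA ler_pM2l ?invr_gt0//; exact: fD.
have Gcvg : within P G --> (0 : X).
  by apply: PC_cvg pcP _ Gweak; exact: withinT.
have [h [h0 hZ [D D0 hD]] h1] := Gcvg _ (nbhsx_ballx (0 : X) _ ltr01).
exists D => // s sP; apply: le_trans (hD s sP).
rewrite big_seq [leRHS]big_seq; apply: ler_sum => x /sP Px.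
(* If [h x < |x|], then [h] is below [1] at the normalized vector [|x|^-1 *: x], which would thus
   lie in the open unit ball. *)
rewrite leNgt; apply/negP => hx.
have x0 : 0 < `|x| by apply: le_lt_trans (h0 x) hx.
have nx0 : 0 <= `|x|^-1 by rewrite invr_ge0.
have : `| `|x|^-1 *: x| < 1.
  have := h1 (`|x|^-1 *: x) _ (PZ _ _ nx0 Px).
  rewrite -ball_normE/= sub0r normrN; apply.
  by rewrite hZ ?invr_gt0// ltr_pdivrMl// mulr1.
by rewrite normrZ ger0_norm// mulVf ?ltxx// gt_eqF.
Qed.

Lemma PC_bounded_base P B : closed P -> convex_cone P -> cone_base P B ->
  PC P 0 -> exists B' : set X, cone_base P B' /\ bounded_set B'.
Proof.
move=> clP coP bB pcP.
have [D D0 PD] := PC_cone_sum_norm clP coP (fun x => cone_base_pointed bB) pcP.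
have PZ : forall (l : R) y, 0 <= l -> P y -> P (l *: y) by case: coP.
(* The convex cone generated by the pairs [(x, |x|)] with [x] in [P]; one-term families will give
   [|x| <= g x]. *)
pose E (y : X) (t : R) := exists2 s : seq X, forall x, x \in s -> P x &
  y = \sum_(x <- s) x /\ t = \sum_(x <- s) `|x|.
have cE : additive_cone E.
  split=> [|x y r t [s sP [-> ->]] [s' sP' [-> ->]]|l x t l0 [s sP [-> ->]]].
  - by exists [::]; rewrite ?big_nil.
  - exists (s ++ s'); last by rewrite !big_cat.
    by move=> z; rewrite mem_cat => /orP[/sP|/sP'].
  - exists [seq l *: x | x <- s].
      by move=> _ /mapP[z /sP Pz ->]; apply: PZ => //; exact: ltW.
    rewrite !big_map scaler_sumr mulr_sumr; split => //.
    by apply: eq_bigr => z _; rewrite normrZ gtr0_norm.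
have [e t [s sP [-> ->]]|g [cg gE]] := cone_separation D0 cE; first exact: PD.
have gP x : P x -> `|x| <= g x.
  move=> Px; apply: gE; exists [:: x]; last by rewrite !big_seq1.
  by move=> y; rewrite inE => /eqP->.
exists [set x | P x /\ g x = 1]; split; last first.
  exists 1; split => // M M1 x [/gP + gx]; rewrite gx => /le_trans; apply.
  exact: ltW.
split=> [|x y l|x []//|x Px x0].
- apply: closedI => //; apply: (@closed_comp _ _ g [set y | y = 1]).
    by move=> ? _; exact: cg.
  exact: closed_eq.
- rewrite !inE => -[Px gx] [Py gy]; split.
    by case: coP => _ /(_ x y l) + _; rewrite !inE; exact.
  have -> : g (conv l x y) = l%:num * g x + (1 - l%:num) * g y.
    by rewrite linearD !linearZ.
  by rewrite gx gy; lra.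
- have gx0 : 0 < g x by apply: lt_le_trans (gP x Px); rewrite normr_gt0.
  exists (g x, (g x)^-1 *: x); split => /= [|[l b] [/= l0 [Pb gb] ->]].
    split => //; last by rewrite scalerA divff ?scale1r// gt_eqF.
    split; first by apply: PZ => //; rewrite invr_ge0 ltW.
    by rewrite linearZ/= [LHS]mulVf// gt_eqF.
  rewrite linearZ/= gb [_ *: _]mulr1; congr (_, _).
  by rewrite scalerA mulVf ?scale1r// gt_eqF.
Qed.

End normal.

(** * From maximality to strict maximality *)

Section strict_maximality.
Context {R : realType} {X : normedModType R}.
Implicit Types (K P : set X) (x : X).

Lemma Max_eq K P x k : Max K P x -> K k -> P (k - x) -> k = x.
Proof.
move=> [Kx /seteqP[_ KP]] Kk Pkx; apply: KP; split => //.
by exists (k - x) => //; rewrite subrKC.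
Qed.

Lemma Max_StMax K P x : weakly_compact K -> closed P -> convex_cone P ->
  Max K P x -> PC P 0 \/ PC K x -> StMax K P x.
Proof.
move=> cK clP coP maxx pcPK; split; first by case: maxx.
move=> e e0; apply: contrapT => nd.
have /choice[kp kpP] (n : nat) : exists kp : X * X, [/\ K kp.1, P kp.2,
    e < `|kp.1 - x| & `|kp.1 - x - kp.2| <= n.+1%:R^-1].
  (* If no such pair existed for [n], [delta = (n + 1)^-1] would serve for [e]. *)
  apply: contrapT => nkp; apply: nd; exists n.+1%:R^-1; first by rewrite invr_gt0.
  move=> _ [[p Pp [b b1 <-]] [k Kk kx]].
  have kxe : `|k - x| <= e.
    rewrite leNgt; apply/negP => kxe; apply: nkp; exists (k, p); split => //=.
    rewrite kx addrAC subrr add0r normrZ ger0_norm ?invr_ge0//.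
    by rewrite ler_piMr ?invr_ge0.
  exists (e^-1 *: (k - x)); last by rewrite scalerA divff ?scale1r ?gt_eqF.
  by rewrite /unit_ball/= normrZ gtr0_norm ?invr_gt0// ler_pdivrMl// mulr1.
pose k n := (kp n).1; pose p n := (kp n).2.
have [U [UU ooU]] := ultraFilterLemma eventually_filter.
have UF : ProperFilter U by exact: ultra_proper.
have kxp0 : (k n - x - p n) @[n --> U] --> (0 : X).
  apply: cvg_trans (@cvg0_le_harmonic R X (fun n => k n - x - p n) _).
    exact: cvg_app.
  by move=> n; have [] := kpP n.
have [l [Kl kl]] : K `&` [set l | (k @ U) --> (l : weak_space X)] !=set0.
  move: cK; rewrite /weakly_compact compact_ultra; apply.
    exact: ultra_fmap.
  by apply: nearW => n; have [] := kpP n.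
have pl : p @ U --> (l - x : weak_space X).
  apply/weak_cvgP => f cf.
  have fk : (f \o k) @ U --> (f l : R^o) := (weak_cvgP l _).1 kl f cf.
  have fkxp : f (k n - x - p n) @[n --> U] --> (0 : R^o).
    by rewrite -(linear0 f); apply: (continuous_cvg _ (cf 0)).
  suff : (f \o p) @ U --> (f (l - x) : R^o) by [].
  (* [p n] is [k n - x] minus an error that tends to [0] in norm. *)
  have -> : f \o p = fun n => f (k n) - f x - f (k n - x - p n).
    by apply/funext => n /=; rewrite !linearB/=; lra.
  rewrite linearB -[X in _ --> X]subr0; apply: (@cvgB _ R^o) => //.
  by apply: (@cvgB _ R^o); [exact: fk|exact: (@cvg_cst R^o)].
have PU : \forall n \near U, P (p n).
  by apply: nearW => n; have [] := kpP n.
have lx : l = x by apply: (Max_eq maxx Kl); exact: (cone_weakly_closed _ clP coP PU pl).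
have kx0 : (k n - x) @[n --> U] --> (0 : X).
  case: pcPK => [pcP|pcK].
    have p0 : p @ U --> (0 : X).
      by apply: (PC_cvg _ pcP PU); move: pl; rewrite lx subrr.
    have -> : (fun n => k n - x) = (fun n => (k n - x - p n) + p n).
      by apply/funext => n; rewrite subrK.
    by rewrite -[X in _ --> X](addr0 (0 : X)); exact: cvgD.
  have kx : k @ U --> x.
    have KU : \forall n \near U, K (k n).
      by apply: nearW => n; have [] := kpP n.
    by apply: (PC_cvg _ pcK KU); rewrite -[X in _ --> X]lx.
  by rewrite -(subrr x); apply: cvgB => //; exact: cvg_cst.
have /cvgr0Pnorm_lt/(_ e e0)/filter_ex[n] := kx0.
by have [_ _ /lt_trans h _] := kpP n => /h; rewrite ltxx.
Qed.

End strict_maximality.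

Unset Implicit Arguments.
Set Strict Implicit.

Theorem theorem3p2 (R : realType) (X : completeNormedModType R)
    (K P : set X) (xbar : X) :
  weakly_compact K -> convex_set K ->
  closed P -> convex_cone P -> (exists B : set X, cone_base P B) ->
  Max K P xbar ->
  (PC P 0 <-> exists B : set X, cone_base P B /\ bounded_set B) /\
  (PC P 0 \/ PC K xbar -> StMax K P xbar).
Proof.
move=> cK _ clP coP [B bB] maxx; split; last exact: Max_StMax.
split=> [|[B' [bB' boundedB']]]; first exact: PC_bounded_base bB.
exact: bounded_base_PC bB' boundedB'.
Qed.
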